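(* Let $n$ be a positive integer and $F_q$ the finite field with $q$ elements. The size of the largest directed clique in $\varTheta(M_n(F_q))$ is $$\sum_{i=0}^{\lfloor n/2\rfloor}\binom{\lfloor n/2\rfloor}{i}_q\binom{\lceil n/2\rceil}{i}_q,$$ and any directed clique of this size is of the form $K(U)$, where $U$ is a subspace of $F_q^n$ with $\dim U$ equal to $\lfloor n/2\rfloor$ or $\lceil n/2\rceil$.
   Context: For a finite unital ring $R$, define $a\sim b$ if and only if $a=bu=vb$ for some units $u,v\in R$; this is an equivalence relation, and $[a]$ denotes the class of $a$. $\varTheta(R)$ is the directed graph whose vertices are the classes $[a]$, $a\in R$, with a directed edge $[x]\to[y]$ ($[x]$, $[y]$ not necessarily distinct) if and only if $xy=0$ (this is well defined). For a finite field $F$, the vertices of $\varTheta(M_n(F))$ are identified with the ordered pairs $(V,W)$ of subspaces of $F^n$ with $\dim V+\dim W=n$ via the bijection $[A]\mapsto(\operatorname{im}A,\ker A)$; under this identification there is an edge $(V_1,W_1)\to(V_2,W_2)$ if and only if $V_2\subseteq W_1$. A directed clique is a subgraph (identified with its set of vertices) in which for any two, not necessarily distinct, vertices $u$ and $v$ there is a directed edge from $u$ to $v$; its size is its number of vertices. For a subspace $U\subseteq F^n$, $K(U)=\{(V,W)\in V(\varTheta(M_n(F))): V\subseteq U\subseteq W\}$, which is a directed clique. $\binom{n}{k}_q$ is the $q$-binomial coefficient, i.e. the number of $k$-dimensional subspaces of $F_q^n$ (zero if $k>n$ or $k<0$). *)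

(* Defs.v *)
From HB Require Import structures.
From mathcomp Require Import all_boot all_order all_algebra.

Set Implicit Arguments.
Unset Strict Implicit.
Unset Printing Implicit Defensive.

Import GRing.Theory.
Local Open Scope ring_scope.

Section Theta.
Variable R : finUnitRingType.

Definition sim (a b : R) : bool :=
  [exists u : R, exists v : R,
     [&& u \is a GRing.unit, v \is a GRing.unit, a == b * u & a == v * b]].

Lemma simP (a b : R) :
  reflect (exists u v : R, [/\ u \is a GRing.unit, v \is a GRing.unit,
                               a = b * u & a = v * b])
          (sim a b).
Proof.
apply: (iffP existsP) => [[u /existsP[v /and4P[Uu Uv /eqP au /eqP av]]]|].
  by exists u, v.
by case=> u [v [Uu Uv au av]]; exists u; apply/existsP; exists v;
  rewrite Uu Uv -au -av !eqxx.
Qed.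

Lemma sim_equiv : equivalence_rel sim.
Proof.
have simR a : sim a a.
  by apply/simP; exists 1, 1; rewrite unitr1 mulr1 mul1r.
have simS a b : sim a b -> sim b a.
  case/simP=> u [v [Uu Uv au av]]; apply/simP; exists u^-1, v^-1.
  by rewrite !unitrV {1}au av mulrK // mulKr.
have simT a b c : sim a b -> sim b c -> sim a c.
  case/simP=> u [v [Uu Uv au av]] /simP[u' [v' [Uu' Uv' bu bv]]].
  apply/simP; exists (u' * u), (v * v').
  by rewrite !unitrMl // mulrA -bu -mulrA -bv.
move=> a b c; split=> // ab.
by apply/idP/idP => [|bc]; [apply: simT; apply: simS | apply: simT bc].
Qed.

Definition cls (a : R) : {set R} := [set b | sim a b].

Definition theta_vertices : {set {set R}} := [set cls a | a : R].

(* Stated on representatives; [theta_edge_cls] shows that the choice of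
   representatives is irrelevant. *)
Definition theta_edge (X Y : {set R}) : bool :=
  [exists x in X, exists y in Y, x * y == 0].

Lemma theta_edge_cls (x y : R) : theta_edge (cls x) (cls y) = (x * y == 0).
Proof.
have simxx : sim x x by have [H _] := sim_equiv x x x.
have simyy : sim y y by have [H _] := sim_equiv y y y.
apply/existsP/eqP => [[x' /andP[]]|xy0]; last first.
  exists x; rewrite inE simxx; apply/existsP; exists y.
  by rewrite inE simyy xy0 eqxx.
rewrite inE => /simP[_ [v [_ Uv _ ->]]] /existsP[y' /andP[]].
rewrite inE => /simP[u [_ [Uu _ -> _]]] /eqP xy0.
by rewrite -mulrA (mulrA x') xy0 mul0r mulr0.
Qed.

(* A directed clique is identified with its set of vertices; [X] and [Y] need
   not be distinct, so every vertex of a directed clique carries a loop. *)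
Definition directed_clique (S : {set {set R}}) : bool :=
  (S \subset theta_vertices) && [forall X in S, forall Y in S, theta_edge X Y].

End Theta.

(* The subspaces of a finite-dimensional space over a finite field form a
   finite type. *)
Section FiniteVspace.
Import VectorInternalTheory.
Variables (F : finFieldType) (vT : vectType F).
HB.instance Definition _ := [Countable of {vspace vT} by <:].
HB.instance Definition _ := [Finite of {vspace vT} by <:].
End FiniteVspace.

Definition qbinom (F : finFieldType) (n k : nat) : nat :=
  #|[set U : {vspace 'cV[F]_n} | \dim U == k]|.

(* Matrices act on column vectors, so that [A *m B = 0] iff
   [im B] is contained in [ker A]. *)
Definition mx_im (F : fieldType) (n : nat) (A : 'M[F]_n) : {vspace 'cV[F]_n} :=
  limg (linfun (mulmx A : 'cV[F]_n -> 'cV[F]_n)).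

Definition mx_ker (F : fieldType) (n : nat) (A : 'M[F]_n) : {vspace 'cV[F]_n} :=
  lker (linfun (mulmx A : 'cV[F]_n -> 'cV[F]_n)).

(* The vertex [cls A] stands for the pair [(mx_im A, mx_ker A)]. *)
Definition Kclique (F : finFieldType) (n : nat) (U : {vspace 'cV[F]_n.+1}) :
    {set {set 'M[F]_n.+1}} :=
  [set cls A | A : 'M[F]_n.+1 & (mx_im A <= U)%VS && (U <= mx_ker A)%VS].

(* Main.v *)
(* If U is the sum of the images of the members of a directed clique, then U
   lies in all their kernels, so the clique is contained in K(U). With
   k = dim U and [a, i] the q-binomial coefficient, K(U) has
   g(k, n - k) = \sum_i [k, i] [n - k, i] elements. By the q-Pascal rule,
   g(a + 1, c) - g(a, c + 1) = \sum_j ([a, j] [c, j + 1] - [a, j + 1] [c, j]);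
   for a < c every term is nonnegative and the term j = 0 is positive, so
   g(k, n - k) is largest exactly at the two middle values of k. *)
Require Import Defs.
From mathcomp Require Import all_boot all_order all_algebra all_field zify.

Set Implicit Arguments.
Unset Strict Implicit.
Unset Printing Implicit Defensive.

Import GRing.Theory.

(** The number of free k-tuples in an n-dimensional space over a field with q elements. For k > n
    the factor i = n makes it 0. *)
Definition qfalling (q n k : nat) := \prod_(i < k) (q ^ n - q ^ i).

(** * Counting subspaces by means of free families *)

Section Counting.
Variable F : finFieldType.
Local Notation q := #|F|.

Let q_gt1 : 1 < q. Proof. exact: finNzRing_gt1. Qed.
Let q_gt0 : 0 < q. Proof. exact: ltnW q_gt1. Qed.

(** Induction on r, adding vectors at the head: over a free [s ++ X] the admissible heads are the
    vectors of V outside its span, which has dimension [size X + r]. *)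
Lemma card_free_extensions N (X : seq 'cV[F]_N) (V : {vspace 'cV[F]_N}) r :
  free X -> (<<X>> <= V)%VS ->
  #|[set s : r.-tuple 'cV[F]_N | free (s ++ X) && (<<s>> <= V)%VS]|
    = \prod_(i < r) (q ^ \dim V - q ^ (size X + i)).
Proof.
move=> fX sXV; elim: r => [|r IHr].
  rewrite big_ord0 -[RHS](card_tuple 0 'cV[F]_N) -cardsT; apply: eq_card => s.
  by rewrite !inE tuple0 fX span_nil sub0v.
rewrite big_ord_recr /= -IHr -sum_nat_const -sum1_card.
rewrite (reindex (fun p : 'cV[F]_N * r.-tuple 'cV[F]_N => [tuple of p.1 :: p.2])) /=;
  last first.
  exists (fun s : r.+1.-tuple 'cV[F]_N => (thead s, [tuple of behead s])).
    by move=> [v s] _; congr (_, _); apply: val_inj.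
  by move=> s _; rewrite -tuple_eta.
pose inV v (s : seq 'cV[F]_N) := (v \in V) && (v \notin <<s ++ X>>%VS).
rewrite (eq_bigl (fun p : 'cV[F]_N * r.-tuple 'cV[F]_N =>
   (p.2 \in [set s : r.-tuple 'cV[F]_N | free (s ++ X) && (<<s>> <= V)%VS])
   && inV p.1 p.2)); last first.
  move=> [v s]; rewrite !inE /inV /= free_cons span_cons subv_add -memvE.
  by rewrite -!andbA; do !bool_congr.
rewrite -(pair_big_dep predT (fun v (s : r.-tuple _) =>
   (s \in [set s : r.-tuple 'cV[F]_N | free (s ++ X) && (<<s>> <= V)%VS]) && inV v s)
   (fun _ _ => 1)) /=.
rewrite (exchange_big_dep (mem [set s : r.-tuple 'cV[F]_N | free (s ++ X) && (<<s>> <= V)%VS])) /=; last first.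
  by move=> v s _ /andP[].
apply: eq_bigr => s sP; move: (sP); rewrite inE => /andP[fsX sV].
have sub : (<<s ++ X>> <= V)%VS by rewrite span_cat subv_add sV.
rewrite -(card_vspace V).
have -> : q ^ (size X + r) = #|<<s ++ X>>%VS|.
  by rewrite card_vspace (eqP fsX) size_cat size_tuple addnC.
rewrite -(cardsE (mem V)) -(cardsE (mem <<s ++ X>>%VS)) -cardsDS; last first.
  by apply/subsetP => v; rewrite !inE; apply: (subvP sub).
rewrite sum1_card; apply: eq_card => v; rewrite !inE.
by rewrite unfold_in /= fsX sV [RHS]andbC.
Qed.

Lemma qfalling_gt0 n k : k <= n -> 0 < qfalling q n k.
Proof.
move=> kn; rewrite /qfalling prodn_cond_gt0 // => i _.
by rewrite subn_gt0 ltn_exp2l // (leq_trans (ltn_ord i)).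
Qed.

Lemma prod_shifted_qfalling n d r :
  \prod_(i < r) (q ^ (d + n) - q ^ (d + i)) = q ^ (d * r) * qfalling q n r.
Proof.
have -> : q ^ (d * r) = \prod_(i < r) q ^ d by rewrite prod_nat_const card_ord expnM.
rewrite -big_split /=.
by apply: eq_bigr => i _; rewrite mulnBr !expnD.
Qed.

(** Double counting: the r-tuples in V that extend a basis X of U to a free family are sorted by the
    subspace W they span together with X. *)
Lemma card_interval_qfalling N (U V : {vspace 'cV[F]_N}) r :
  (U <= V)%VS ->
  #|[set W : {vspace 'cV[F]_N} |
      [&& (U <= W)%VS, (W <= V)%VS & \dim W == \dim U + r]]| * qfalling q r r
  = qfalling q (\dim V - \dim U) r.
Proof.
(* Multiplying by q^(r dim U) turns both [qfalling] factors into counts of free extensions of X,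
   inside W and inside V. *)
move=> sUV; have qr_gt0 : 0 < q ^ (\dim U * r) by rewrite expn_gt0 q_gt0.
apply/eqP; rewrite -(eqn_pmul2l qr_gt0) -prod_shifted_qfalling.
rewrite subnKC ?dimvS // mulnCA -prod_shifted_qfalling; apply/eqP.
have fX := basis_free (vbasisP U); have sX := span_basis (vbasisP U).
set X : seq _ := vbasis U in fX sX; have szX : size X = \dim U.
  by rewrite size_tuple.
pose T W := [set s : r.-tuple 'cV[F]_N | free (s ++ X) && (<<s>> <= W)%VS].
have cT (W : {vspace 'cV[F]_N}) : (U <= W)%VS ->
    #|T W| = \prod_(i < r) (q ^ \dim W - q ^ (\dim U + i)).
  by move=> sUW; rewrite card_free_extensions ?szX ?sX.
rewrite -(cT V) // -[#|T V|]sum1_card -sum_nat_const.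
set I := finset _; rewrite (partition_big (fun s : r.-tuple _ => <<s ++ X>>%VS) (mem I)) /=.
  apply: eq_bigr => W; rewrite inE => /and3P[sUW sWV /eqP dW].
  rewrite -dW -cT // -sum1_card; apply: eq_bigl => s; rewrite !inE.
  rewrite -andbA; case fsX: (free _) => //=.
  have dsX : \dim <<s ++ X>> = \dim W.
    by rewrite (eqP fsX) size_cat szX size_tuple dW addnC.
  apply/idP/andP => [sW|[_ /eqP <-]].
    split; first exact: subv_trans sW sWV.
    by rewrite eqEdim dsX leqnn andbT span_cat subv_add sW sX.
  by rewrite span_cat addvSl.
move=> s; rewrite !inE => /andP[fsX sV].
by rewrite (eqP fsX) size_cat szX size_tuple addnC eqxx span_cat subv_add sV sX sUV addvSr.
Qed.

(** A division-free quotient formula: identities between q-binomials are proved below by multiplying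
    by the positive [qfalling q k k] and cancelling it. *)
Lemma qbinomE n k : qbinom F n k * qfalling q k k = qfalling q n k.
Proof.
have := @card_interval_qfalling n 0%VS fullv k (sub0v _).
rewrite dimv0 subn0 dimvf /dim /= muln1 => <-; congr (_ * _).
by apply: eq_card => W; rewrite !inE sub0v subvf.
Qed.

(** This is the count in V/U, obtained without quotient spaces by comparing both sides through
    [qfalling]. *)
Lemma card_interval N (U V : {vspace 'cV[F]_N}) r :
  (U <= V)%VS ->
  #|[set W : {vspace 'cV[F]_N} |
      [&& (U <= W)%VS, (W <= V)%VS & \dim W == \dim U + r]]|
  = qbinom F (\dim V - \dim U) r.
Proof.
move=> sUV; apply/eqP; rewrite -(eqn_pmul2r (qfalling_gt0 (leqnn r))).
by rewrite card_interval_qfalling // qbinomE.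
Qed.

(** * Identities and inequalities for q-binomials *)

Lemma qfallingS n k : qfalling q n k.+1 = qfalling q n k * (q ^ n - q ^ k).
Proof. by rewrite /qfalling big_ord_recr. Qed.

(** Here the first factor is split off, and each remaining factor yields one q. *)
Lemma qfallingSS n k :
  qfalling q n.+1 k.+1 = (q ^ n.+1 - 1) * (q ^ k * qfalling q n k).
Proof.
rewrite {1}/qfalling big_ord_recl expn0; congr (_ * _).
by have := prod_shifted_qfalling n 1 k; rewrite mul1n add1n => <-.
Qed.

Lemma qfalling_small n k : n < k -> qfalling q n k = 0.
Proof.
by move=> nk; rewrite /qfalling (bigD1 (Ordinal nk)) //= subnn mul0n.
Qed.

Lemma qbinom_small n k : n < k -> qbinom F n k = 0.
Proof.
move=> nk; apply/eqP; rewrite -(eqn_pmul2r (qfalling_gt0 (leqnn k))).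
by rewrite qbinomE qfalling_small.
Qed.

Lemma qbinom0 n : qbinom F n 0 = 1.
Proof. by have := qbinomE n 0; rewrite /qfalling !big_ord0 muln1. Qed.

Lemma qbinom1 n : qbinom F n 1 * (q - 1) = q ^ n - 1.
Proof. by have := qbinomE n 1; rewrite /qfalling !big_ord1. Qed.

(* [q^(k(n-k)) P(k,k) P(n-k,n-k)], with [P] the [qfalling] products, is symmetric
   under [k <-> n - k], and [P(n,n)] is its product with the q-binomial. *)
Lemma qbinom_sub n k : k <= n -> qbinom F n (n - k) = qbinom F n k.
Proof.
have full j : j <= n ->
    qbinom F n j * (q ^ (j * (n - j)) * qfalling q j j * qfalling q (n - j) (n - j))
    = qfalling q n n.
  move=> jn; rewrite [q ^ _ * _]mulnC -mulnA mulnA qbinomE.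
  rewrite -prod_shifted_qfalling subnKC //.
  have -> : qfalling q n n = \prod_(i < j + (n - j)) (q ^ n - q ^ i) by rewrite subnKC.
  by rewrite big_split_ord.
move=> kn; have := full _ kn; rewrite -(full (n - k)) ?leq_subr // subKn //.
rewrite [(n - k) * k]mulnC [in RHS]mulnAC => /eqP.
rewrite eqn_pmul2r => [/eqP -> //|].
by rewrite !muln_gt0 !qfalling_gt0 // expn_gt0 q_gt0.
Qed.

(** The q-Pascal rule. Once denominators are cleared, q^k [qfalling q n k] is a common factor, and
    what remains is q^(n+1) - 1 = (q^(n+1) - q^(k+1)) + (q^(k+1) - 1). *)
Lemma qbinomSS n k :
  qbinom F n.+1 k.+1 = q ^ k.+1 * qbinom F n k.+1 + qbinom F n k.
Proof.
have [nk|kn] := ltnP n k.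
  by rewrite !qbinom_small ?muln0 // ltnS ltnW.
have tail : qbinom F n k * qfalling q k.+1 k.+1
            = (q ^ k.+1 - 1) * (q ^ k * qfalling q n k).
  by rewrite qfallingSS mulnCA [X in _ * X = _]mulnCA qbinomE.
apply/eqP; rewrite -(eqn_pmul2r (qfalling_gt0 (leqnn k.+1))) mulnDl tail.
rewrite -mulnA !qbinomE qfallingSS qfallingS; apply/eqP.
have -> : q ^ k.+1 * (qfalling q n k * (q ^ n - q ^ k))
          = (q ^ n.+1 - q ^ k.+1) * (q ^ k * qfalling q n k).
  by rewrite !expnS -mulnBr [RHS]mulnACA; congr (_ * _); apply: mulnC.
rewrite -mulnDl; congr (_ * _).
(* These two bounds ensure that no subtraction is truncated. *)
have : q ^ k.+1 <= q ^ n.+1 by rewrite leq_exp2l.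
have : 0 < q ^ k.+1 by rewrite expn_gt0 q_gt0.
move: (q ^ _) (q ^ _) => x y; lia.
Qed.

(** Passing from [x, j] to [x, j + 1] multiplies by q^x - q^j and a constant depending only on j, so
    the gain grows with x. *)
Lemma qbinom_cross_le a c j : a <= c ->
  qbinom F a j.+1 * qbinom F c j <= qbinom F a j * qbinom F c j.+1.
Proof.
move=> ac; have P_gt0 := qfalling_gt0 (leqnn _).
rewrite -(leq_pmul2r (P_gt0 j)) -(leq_pmul2r (P_gt0 j.+1)).
have -> : qbinom F a j.+1 * qbinom F c j * qfalling q j j * qfalling q j.+1 j.+1
          = qfalling q a j * (q ^ a - q ^ j) * qfalling q c j.
  by rewrite -mulnA [qfalling _ _ _ * _]mulnC mulnACA !qbinomE qfallingS.
have -> : qbinom F a j * qbinom F c j.+1 * qfalling q j j * qfalling q j.+1 j.+1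
          = qfalling q a j * (q ^ c - q ^ j) * qfalling q c j.
  by rewrite -mulnA mulnACA !qbinomE qfallingS mulnA mulnAC.
rewrite leq_mul2r leq_mul2l leq_sub2r ?orbT //.
by rewrite leq_exp2l.
Qed.

(** * Sums of products of q-binomials and their maximum *)

Lemma qbinom1_lt a c : a < c -> qbinom F a 1 < qbinom F c 1.
Proof.
move=> ac; rewrite -(ltn_pmul2r (_ : 0 < q - 1)) ?subn_gt0 // !qbinom1.
by apply: ltn_sub2r; rewrite -?[1](expn0 q) ltn_exp2l // (leq_trans _ ac).
Qed.

(** Terms with i > min(a, b) vanish; a range independent of a and b lets two such sums be compared
    term by term. *)
Definition qsum n a b := \sum_(i < n.+1) qbinom F a i * qbinom F b i.

Lemma qsumC n a b : qsum n a b = qsum n b a.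
Proof. by apply: eq_bigr => i _; rewrite mulnC. Qed.

Lemma qsum_lt n a c : 0 < n -> a < c -> qsum n a c.+1 < qsum n a.+1 c.
Proof.
case: n => // n _ ac; rewrite /qsum !big_ord_recl /= /bump /= !add1n !qbinom0 ltn_add2l.
(* The difference of the terms of index j + 1, with negative parts moved across; the two q^(j+1)
   products from q-Pascal coincide. *)
have key j : qbinom F a j.+1 * qbinom F c.+1 j.+1 + qbinom F a j * qbinom F c j.+1
    = qbinom F a.+1 j.+1 * qbinom F c j.+1 + qbinom F a j.+1 * qbinom F c j.
  by rewrite !qbinomSS mulnDr mulnDl addnAC mulnCA mulnA.
(* The strictness is put on the term of index 1, present since n > 0. *)
rewrite -addSn leq_add //.
  have := key 0; rewrite !qbinom0 mul1n muln1 => e.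
  by rewrite -(ltn_add2r (qbinom F c 1)) e ltn_add2l qbinom1_lt.
apply: leq_sum => j _; rewrite -(leq_add2r (qbinom F a j.+1 * qbinom F c j.+2)).
rewrite key leq_add2l qbinom_cross_le //.
exact: ltnW.
Qed.

(** By symmetry k lies at or below the middle; from there each step k to k + 1 strictly increases
    the sum, which also settles the equality case. *)
Lemma qsum_le_balanced n k : k <= n ->
  qsum n k (n - k) <= qsum n n./2 (uphalf n)
  ?= iff (k == n./2) || (k == uphalf n).
Proof.
move=> kn; have e := odd_double_half n; have u := uphalf_half n.
wlog le_k : k kn / k <= n./2 => [hw|].
  have [|lt] := leqP k n./2; first exact: hw.
  have := hw (n - k) (leq_subr _ _); rewrite subKn // qsumC => {}hw.
  have -> : (k == n./2) || (k == uphalf n)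
            = (n - k == n./2) || (n - k == uphalf n) by lia.
  by apply: hw; lia.
have lt_half j d : j + d.+1 = n./2 ->
    qsum n j (n - j) < qsum n n./2 (uphalf n).
  elim: d j => [|d IHd] j jd; last apply: ltn_trans (IHd j.+1 _); try lia.
    have -> : n - j = (uphalf n).+1 by lia.
    have <- : j.+1 = n./2 by lia.
    by apply: qsum_lt; lia.
  have -> : n - j = (n - j.+1).+1 by lia.
  by apply: qsum_lt; lia.
move: le_k; rewrite leq_eqVlt => /predU1P[->|lt].
  rewrite eqxx; have -> : n - n./2 = uphalf n by lia.
  exact/leqif_refl.
have ltS : qsum n k (n - k) < qsum n n./2 (uphalf n).
  by apply: (lt_half k (n./2 - k.+1)); lia.
have -> : (k == n./2) || (k == uphalf n) = false by lia.
by split; [exact: ltnW | rewrite ltn_eqF].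
Qed.

Lemma qsumE n a b :
  a <= n -> qsum n a b = \sum_(0 <= i < a.+1) qbinom F a i * qbinom F b i.
Proof.
move=> an; rewrite /qsum -(big_mkord predT (fun i => qbinom F a i * qbinom F b i)).
rewrite (@big_cat_nat _ _ _ a.+1) //= -[RHS]addn0; congr (_ + _).
rewrite big_nat big1 // => i /andP[ai _].
by rewrite qbinom_small.
Qed.

(** * Counting the pairs around a subspace *)

Lemma card_subspaces N (U : {vspace 'cV[F]_N}) i :
  #|[set V : {vspace 'cV[F]_N} | (V <= U)%VS & \dim V == i]|
  = qbinom F (\dim U) i.
Proof.
have := card_interval i (sub0v U); rewrite dimv0 subn0 => <-.
by apply: eq_card => V; rewrite !inE sub0v.
Qed.

(** The interval count gives the lower index N - dim U - i, and symmetry replaces it by i. The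
    additive form of the dimension condition remains correct for i > N, where N - i would be
    truncated. *)
Lemma card_superspaces N (U : {vspace 'cV[F]_N}) i :
  #|[set W : {vspace 'cV[F]_N} | (U <= W)%VS & i + \dim W == N]|
  = qbinom F (N - \dim U) i.
Proof.
have dN : \dim (fullv : {vspace 'cV[F]_N}) = N by rewrite dimvf /dim /= muln1.
have dU : \dim U <= N by rewrite -[leqRHS]dN dimvS ?subvf.
have [iU|Ui] := leqP i (N - \dim U).
  rewrite -[RHS]qbinom_sub // -[N in qbinom F (N - _)]dN.
  rewrite -(card_interval (N - \dim U - i) (subvf U)).
  apply: eq_card => W; rewrite !inE subvf; congr (_ && _); lia.
rewrite [RHS]qbinom_small //; apply: eq_card0 => W; rewrite !inE.
by apply/negP => /andP[/dimvS]; lia.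
Qed.

(** Pairs are sorted by i = dim V; the number of possible W depends on V only through i. *)
Lemma card_flags_around N (U : {vspace 'cV[F]_N}) :
  #|[set p : {vspace 'cV[F]_N} * {vspace 'cV[F]_N} |
      [&& (p.1 <= U)%VS, (U <= p.2)%VS & \dim p.1 + \dim p.2 == N]]|
  = qsum N (\dim U) (N - \dim U).
Proof.
rewrite -sum1_card; under eq_bigl do rewrite inE.
rewrite -(pair_big_dep (fun V => (V <= U)%VS)
  (fun V W : {vspace 'cV[F]_N} => (U <= W)%VS && (\dim V + \dim W == N)) (fun _ _ => 1)) /=.
have dN : \dim (fullv : {vspace 'cV[F]_N}) = N by rewrite dimvf /dim /= muln1.
have dV (V : {vspace 'cV[F]_N}) : \dim V < N.+1.
  by rewrite ltnS -[leqRHS]dN dimvS ?subvf.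
rewrite (partition_big (fun V => Ordinal (dV V)) predT) //=.
apply: eq_bigr => i _; rewrite -card_subspaces -sum_nat_const.
apply: eq_big => [V|V /andP[_ /eqP <-]]; first by rewrite !inE.
by rewrite sum1_card -card_superspaces; apply: eq_card => W; rewrite !inE.
Qed.

End Counting.

(** * Images and kernels of matrices *)

Section Vertices.
Variables (F : finFieldType) (n : nat).
Local Open Scope ring_scope.
Implicit Types A B : 'M[F]_n.

Lemma mx_im_sub A (U : {vspace 'cV[F]_n}) :
  reflect (forall x, A *m x \in U) (mx_im A <= U)%VS.
Proof.
apply: (iffP subvP) => [sAU x|sAU _ /memv_imgP[x _ ->]]; last by rewrite lfunE sAU.
by rewrite sAU // -[A *m x](lfunE (mulmx A)) memv_img ?memvf.
Qed.

Lemma mem_mx_im A x : A *m x \in mx_im A.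
Proof. by move: x; apply/mx_im_sub. Qed.

Lemma mem_mx_ker A x : (x \in mx_ker A) = (A *m x == 0).
Proof. by rewrite memv_ker lfunE. Qed.

Lemma mulmx_eq0_im_ker A B : (A *m B == 0) = (mx_im B <= mx_ker A)%VS.
Proof.
apply/eqP/mx_im_sub => [AB0 x|sBA]; first by rewrite mem_mx_ker mulmxA AB0 mul0mx.
apply/matrixP => i j; have := sBA (delta_mx j 0).
by rewrite mem_mx_ker mulmxA -colE => /eqP/matrixP/(_ i 0); rewrite !mxE.
Qed.

Lemma dim_mx_im_ker A : (\dim (mx_im A) + \dim (mx_ker A))%N = n.
Proof. by rewrite addnC -[mx_ker A]capfv limg_ker_dim dimvf /dim /= muln1. Qed.

(** The columns of [cokermx B] lie in ker B, so if ker B is inside ker A they are killed by A, which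
    is the criterion for inclusion of row spaces. *)
Lemma mx_ker_subP A B : reflect (A <= B)%MS (mx_ker B <= mx_ker A)%VS.
Proof.
rewrite submxE; apply: (iffP idP) => [sBA|AB0].
  rewrite mulmx_eq0_im_ker (subv_trans _ sBA) //.
  by rewrite -mulmx_eq0_im_ker mulmx_coker.
apply/subvP => x; rewrite !mem_mx_ker => /eqP Bx0.
have /submxP[D ->] : (A <= B)%MS by rewrite submxE.
by rewrite -mulmxA Bx0 mulmx0.
Qed.

Lemma mx_im_subP A B : reflect (A^T <= B^T)%MS (mx_im A <= mx_im B)%VS.
Proof.
apply: (iffP idP) => [sAB|/submxP[D]]; last first.
  move/(congr1 trmx); rewrite trmx_mul !trmxK => ->.
  by apply/mx_im_sub => x; rewrite -mulmxA mem_mx_im.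
apply/row_subP => i; have /memv_imgP[x _] := subvP sAB _ (mem_mx_im A (delta_mx i 0)).
rewrite lfunE /= -colE => /(congr1 trmx); rewrite tr_col trmx_mul => ->.
exact: submxMl.
Qed.

(** The map sends a basis of W to 0 and a basis of a complement of W to a basis of V; the lengths
    agree by the dimension hypothesis. *)
Lemma exists_mx_im_ker (V W : {vspace 'cV[F]_n}) :
  (\dim V + \dim W)%N = n -> exists A, mx_im A = V /\ mx_ker A = W.
Proof.
move=> dVW; pose X := vbasis W ++ vbasis (W^C).
have dN : \dim (fullv : {vspace 'cV[F]_n}) = n by rewrite dimvf /dim /= muln1.
have dWC : \dim (W^C) = \dim V.
  by rewrite dimv_compl dN -[X in (X - _)%N]dVW addnK.
have dX : <<X>>%VS = fullv.
  by rewrite span_cat !(span_basis (vbasisP _)) addv_complf.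
have fX : free X.
  by rewrite /free dX size_cat !size_tuple dWC addnC dVW dN.
pose Y := nseq (\dim W) 0 ++ vbasis V.
have szY : size Y = size X by rewrite !size_cat size_nseq !size_tuple dWC.
have [f /(_ fX szY) fXY] := linear_of_free X Y.
pose A := \matrix_(i, j) f (delta_mx j 0) i 0.
have Af x : A *m x = f x.
  rewrite {2}(matrix_sum_delta x) linear_sum; apply/colP => i.
  rewrite mxE summxE; apply: eq_bigr => j _.
  by rewrite big_ord1 linearZ !mxE mulrC.
have Xf (Z : seq 'cV[F]_n) : map (linfun (mulmx A : 'cV[F]_n -> 'cV[F]_n)) Z = map f Z.
  by apply: eq_map => x; rewrite lfunE /= Af.
have imA : mx_im A = V.
  rewrite /mx_im -dX limg_span Xf fXY span_cat (span_basis (vbasisP V)).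
  rewrite (_ : <<nseq _ (0 : 'cV[F]_n)%R>>%VS = 0%VS) ?add0v //; apply/eqP.
  by rewrite -subv0; apply/span_subvP => x /nseqP[-> _]; rewrite mem0v.
(* Only W inside the kernel is checked directly; rank-nullity gives equality. *)
exists A; split=> //; symmetry; apply/eqP; rewrite eqEdim; apply/andP; split.
  rewrite -(span_basis (vbasisP W)); apply/span_subvP => x xW.
  rewrite mem_mx_ker Af.
  move/eqP: fXY; rewrite map_cat eqseq_cat ?size_map ?size_nseq ?size_tuple //.
  by case/andP=> /eqP fW _; have := map_f f xW; rewrite fW mem_nseq => /andP[].
by rewrite -(leq_add2l (\dim V)) dVW -{1}imA dim_mx_im_ker.
Qed.

End Vertices.

(** * Classes of matrices and directed cliques *)

Section Cliques.
Variables (F : finFieldType) (m : nat).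
Let n := m.+1.
Local Open Scope ring_scope.
Implicit Types (A B : 'M[F]_n) (S : {set {set 'M[F]_n}}).

Lemma eq_cls (R : finUnitRingType) (a b : R) : (cls a == cls b) = sim a b.
Proof.
have simR x : sim x x by case: (sim_equiv x x x).
apply/eqP/idP => [/setP/(_ b)|ab]; first by rewrite !inE simR.
by apply/setP => c; rewrite !inE; case: (sim_equiv a b c) => _; apply.
Qed.

(** Equal kernels mean equal row spaces, hence a unit on the left; equal images mean equal column
    spaces, hence a unit on the right. *)
Lemma sim_im_ker A B :
  sim A B = (mx_im A == mx_im B) && (mx_ker A == mx_ker B).
Proof.
apply/simP/andP => [[u [v [Uu Uv Au Av]]]|[/eqP imAB /eqP kerAB]].
  split; rewrite eqEsubv; apply/andP; split.
  - by rewrite Au; apply/mx_im_sub => x; rewrite -mulmxA mem_mx_im.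
  - have -> : B = A * u^-1 by rewrite Au mulrK.
    by apply/mx_im_sub => x; rewrite -mulmxA mem_mx_im.
  - have -> : B = v^-1 * A by rewrite Av mulKr.
    by apply/mx_ker_subP; apply: submxMl.
  - by rewrite Av; apply/mx_ker_subP; apply: submxMl.
have /eqmxMunitP[v Uv Av] : (A == B)%MS.
  by apply/andP; split; apply/mx_ker_subP; rewrite kerAB.
have /eqmxMunitP[u Uu Au] : (A^T == B^T)%MS.
  by apply/andP; split; apply/mx_im_subP; rewrite imAB.
exists u^T, v; split=> //; first by rewrite unitmx_tr.
by rewrite -[A]trmxK Au trmx_mul trmxK.
Qed.

Lemma card_Kclique (U : {vspace 'cV[F]_n}) :
  #|Kclique U| = qsum F n (\dim U) (n - \dim U).
Proof.
pose im_ker A := (mx_im A, mx_ker A).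
(* The default 0 is never reached on pairs [im_ker A], and by [PP] below all pairs counted are of
   this form. *)
pose rep p := odflt 0 [pick A | im_ker A == p].
have repK A : im_ker (rep (im_ker A)) = im_ker A.
  by rewrite /rep; case: pickP => [B /eqP //|/(_ A)]; rewrite eqxx.
have cls_rep A : cls (rep (im_ker A)) = cls A.
  apply/eqP; rewrite eq_cls sim_im_ker.
  by rewrite -[_ && _]/(im_ker _ == im_ker _) repK.
rewrite -card_flags_around; set P := finset _.
have PP p : p \in P -> exists2 A, p = im_ker A & (mx_im A <= U <= mx_ker A)%VS.
  case: p => V W; rewrite inE /= => /and3P[sVU sUW /eqP/exists_mx_im_ker].
  by case=> A [imA kerA]; exists A; rewrite /im_ker ?imA ?kerA // sVU.
rewrite -(@card_in_imset _ _ (fun p => cls (rep p))) => [|p p' /PP[A -> _] /PP[B -> _]].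
  apply: eq_card => X; apply/imsetP/imsetP => [[A]|[p /PP[A -> AU] ->]].
    rewrite inE => /andP[imA kerA] ->; exists (im_ker A); last by rewrite cls_rep.
    by rewrite inE imA kerA dim_mx_im_ker eqxx.
  by exists A; rewrite ?inE // cls_rep.
by move/eqP; rewrite !cls_rep eq_cls sim_im_ker /im_ker => /andP[/eqP-> /eqP->].
Qed.

Lemma Kclique_directed (U : {vspace 'cV[F]_n}) : directed_clique (Kclique U).
Proof.
apply/andP; split; first by apply/subsetP => _ /imsetP[A _ ->]; apply: imset_f.
apply/forall_inP => _ /imsetP[A + ->]; rewrite inE => /andP[_ kerA].
apply/forall_inP => _ /imsetP[B + ->]; rewrite inE => /andP[imB _].
by rewrite theta_edge_cls [_ == _]mulmx_eq0_im_ker (subv_trans imB).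
Qed.

Lemma directed_clique_sub_Kclique S :
  directed_clique S -> exists U : {vspace 'cV[F]_n}, S \subset Kclique U.
Proof.
case/andP=> /subsetP Svtx /forall_inP edgeS.
(* Summing over all matrices whose class is in S avoids choosing representatives. *)
exists (\sum_(A | cls A \in S) mx_im A)%VS; apply/subsetP => X XS.
have /imsetP[A _ XA] := Svtx _ XS; rewrite XA in XS *.
apply: imset_f; rewrite inE; apply/andP; split; first exact: (sumv_sup A).
(* B may be in the class of A: the loops of the clique are used here. *)
apply/subv_sumP => B BS; rewrite -mulmx_eq0_im_ker.
by have /forall_inP/(_ _ BS) := edgeS _ XS; rewrite theta_edge_cls.
Qed.

End Cliques.

Theorem proposition3p7 (F : finFieldType) (m : nat) :
  let n := m.+1 in
  let N := \sum_(0 <= i < n./2.+1) qbinom F n./2 i * qbinom F (uphalf n) i in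
  \max_(S : {set {set 'M[F]_n}} | directed_clique S) #|S| = N
  /\ forall S : {set {set 'M[F]_n}},
       directed_clique S -> #|S| = N ->
       exists U : {vspace 'cV[F]_n},
         (\dim U = n./2 \/ \dim U = uphalf n) /\ S = Kclique U.
Proof.
move=> n N.
have NE : N = qsum F n n./2 (uphalf n) by rewrite qsumE //; lia.
have leN (U : {vspace 'cV[F]_n}) :
    #|Kclique U| <= N ?= iff (\dim U == n./2) || (\dim U == uphalf n).
  rewrite card_Kclique NE; apply: qsum_le_balanced.
  by have := dimvS (subvf U); rewrite dimvf /dim /= muln1.
(* A subspace of middle dimension, needed for the bound to be attained. *)
have [U dU] : exists U : {vspace 'cV[F]_n}, \dim U = n./2.
  have : 0 < qbinom F n n./2.
    have half_le : n./2 <= n by lia.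
    by have := qfalling_gt0 F half_le; rewrite -qbinomE muln_gt0 => /andP[].
  by case/card_gt0P => U; rewrite inE => /eqP; exists U.
split.
  apply/eqP; rewrite eqn_leq; apply/andP; split.
    apply/bigmax_leqP => S /directed_clique_sub_Kclique[W /subset_leq_card SW].
    exact: leq_trans SW (leN W).1.
  have <- : #|Kclique U| = N by apply/eqP; rewrite (leN U).2 dU eqxx.
  exact: leq_bigmax_cond (Kclique_directed U).
move=> S /directed_clique_sub_Kclique[W SW] cS; exists W.
(* N = |S| <= |K(W)| <= N forces S = K(W), and the equality case of [leN] gives dim W. *)
have cW : #|Kclique W| = N.
  by apply/eqP; rewrite eqn_leq (leN W).1 -cS subset_leq_card.
split; last by apply/eqP; rewrite eqEcard SW cS cW leqnn.
by move/eqP: cW; rewrite (leN W).2 => /orP[] /eqP; [left | right].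
Qed.
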